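(* Suppose that $q\in(0,1)$, and that $a\neq 0$ and $b$ are real numbers with $b<0$ and $|b|>|a|$, and put $\kappa=-\log|b/a|/\log(1/q)$. Let $f\in C([0,\infty);\mathbb{R})$, let $\zeta\in\mathbb{R}$, and let $x$ be the unique continuous solution of $$x'(t)=ax(qt)+bx(t)+f(t),\quad t\ge 0;\qquad x(0)=\zeta .$$ Let $y$ be the unique continuous solution of $y'(t)=-y(t)+f(t)$, $t\ge 0$, $y(0)=0$. For $\theta\in[0,1]$ and $t\ge 0$ let $f_\theta(t)=\int_{(t-\theta)^+}^t f(s)\,ds$. Suppose that $\gamma:[0,\infty)\to(0,\infty)$ is continuous and obeys either (i) $\gamma\in\mathrm{RV}_\infty(\eta)$ for some $\eta>\kappa$, or (ii) $\gamma$ is increasing and in $C^1$, with $\gamma(t)\to\infty$ as $t\to\infty$. Consider the conditions: $$(\alpha)\quad \text{there is } K>0 \text{ such that } \sup_{0\le\theta\le1}|f_\theta(t)|\le K\gamma(t)\ \text{ for all } t\ge 0;$$ $$(\beta)\quad f_\theta(t)=o(\gamma(t))\ \text{ as } t\to\infty, \text{ for each } \theta\in[0,1];$$ $$(\delta)\quad \text{there exists } \theta'\in(0,1] \text{ such that } \limsup_{t\to\infty}\frac{|f_{\theta'}(t)|}{\gamma(t)}>0.$$ Then: (I) The following three statements are equivalent: $(\alpha)$ holds; $y(t)=O(\gamma(t))$ as $t\to\infty$; $x(t)=O(\gamma(t))$ as $t\to\infty$. (II) The following three statements are equivalent: $(\beta)$ holds; $y(t)=o(\gamma(t))$ as $t\to\infty$;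 $x(t)=o(\gamma(t))$ as $t\to\infty$. (III) The following three statements are equivalent: $(\alpha)$ and $(\delta)$ both hold; $\limsup_{t\to\infty}|y(t)|/\gamma(t)\in(0,\infty)$; $\limsup_{t\to\infty}|x(t)|/\gamma(t)\in(0,\infty)$.
   Context: $\gamma\in\mathrm{RV}_\infty(\eta)$ means that $\gamma:[0,\infty)\to(0,\infty)$ is measurable and regularly varying at infinity with index $\eta\in\mathbb{R}$: $\lim_{t\to\infty}\gamma(\lambda t)/\gamma(t)=\lambda^\eta$ for every $\lambda>0$. Here $u^+=\max(u,0)$. *)

(* Defs.v *)
From HB Require Import structures.
From mathcomp Require Import all_boot all_order all_algebra.
From mathcomp Require Import all_classical all_reals all_analysis.

Set Implicit Arguments.
Unset Strict Implicit.
Unset Printing Implicit Defensive.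

Import Order.TTheory GRing.Theory Num.Theory.
Import numFieldNormedType.Exports.

Local Open Scope classical_set_scope.
Local Open Scope ring_scope.

(* A function on [0, oo) is represented by a total function on R whose values
   at negative arguments are arbitrary; nothing below depends on them. *)

Definition continuous_halfline (R : realType) (g : R -> R) : Prop :=
  {within `[0, +oo[, continuous g}.

(* At 0 the derivative is the right-hand one. *)
Definition derivative_halfline (R : realType) (g g' : R -> R) : Prop :=
  (forall t : R, 0 < t -> is_derive t 1 g (g' t)) /\
  (h^-1 * (g h - g 0)) @[h --> 0^'+] --> g' 0.

Definition C1_halfline (R : realType) (g : R -> R) : Prop :=
  continuous_halfline g /\
  exists g' : R -> R, continuous_halfline g' /\ derivative_halfline g g'.

Definition pantograph_solution (R : realType) (q a b zeta : R) (f x : R -> R)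
    : Prop :=
  [/\ continuous_halfline x,
      derivative_halfline x (fun t => a * x (q * t) + b * x t + f t)
    & x 0 = zeta].

Definition ode_solution (R : realType) (f y : R -> R) : Prop :=
  [/\ continuous_halfline y,
      derivative_halfline y (fun t => - y t + f t)
    & y 0 = 0].

Definition window_integral (R : realType) (f : R -> R) (theta t : R) : R :=
  \int[@lebesgue_measure R]_(s in `[Num.max (t - theta) 0, t]) f s.

Definition regularly_varying (R : realType) (eta : R) (gamma : R -> R) : Prop :=
  [/\ measurable_fun (`[0, +oo[%classic : set R) gamma,
      forall t : R, 0 <= t -> 0 < gamma t
    & forall lambda : R, 0 < lambda ->
        (gamma (lambda * t) / gamma t) @[t --> +oo] --> lambda `^ eta].

(* The filter +oo, packaged as the Landau notations require. *)
Definition at_infty {R : realType} : filter_on R :=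
  FilterType (pinfty_nbhs R) _.

Definition limsup_ratio (R : realType) (g gamma : R -> R) : \bar R :=
  limf_esup (fun t => (`|g t| / gamma t)%:E) (+oo : set_system R).

Definition window_sup (R : realType) (f : R -> R) (t : R) : \bar R :=
  ereal_sup [set (`|window_integral f theta t|)%:E |
             theta in (`[0, 1]%classic : set R)].

Definition cond_alpha (R : realType) (f gamma : R -> R) : Prop :=
  exists2 K : R, 0 < K &
    forall t : R, 0 <= t -> (window_sup f t <= (K * gamma t)%:E)%E.

Definition cond_beta (R : realType) (f gamma : R -> R) : Prop :=
  forall theta : R, 0 <= theta <= 1 -> window_integral f theta =o_at_infty gamma.

Definition cond_delta (R : realType) (f gamma : R -> R) : Prop :=
  exists2 theta : R, 0 < theta <= 1 &
    (0 < limsup_ratio (window_integral f theta) gamma)%E.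

(* Main.v *)
Require Import Defs.
From HB Require Import structures.
From mathcomp Require Import all_boot all_order all_algebra.
From mathcomp Require Import all_classical all_reals all_analysis.
From mathcomp Require Import ring lra.
Import Order.TTheory GRing.Theory Num.Theory.
Import numFieldNormedType.Exports.
Local Open Scope classical_set_scope.
Local Open Scope ring_scope.

(** The regularly varying and the increasing weight enter the proof through two
    common properties only, gathered in [tame]: shifting the argument back by
    at most 1 increases [gamma] at most by a factor tending to 1, and scaling it by [q]
    multiplies [gamma] by at most some [L] with [|a| L < |b|].  For an
    increasing weight [L = 1] works.  For a regularly varying one the shift
    bound is the uniform convergence theorem, and [L] is any number between
    [q^eta] and [|b/a|]: since [|b/a| = q^kappa] and [q < 1], the hypothesis
    [eta > kappa] says exactly that this gap is nonempty.

    For such a weight, a solution of [z'(t) = a z(qt) + b z(t) + g(t)] satisfies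
    [|z| <= C K gamma] eventually as soon as [|g| <= K gamma] eventually, where
    [C] depends on neither [z] nor [K] ([pantograph_comparison]).  Indeed, over
    a unit of time an eventual bound [|z| <= M gamma] improves to
    [|z| <= (r M + C1 K) gamma] with [r < 1], so that iteration forgets the
    initial data.  Because [C] is uniform in [K], one such estimate yields the
    big-O statement (some [K]) and the little-o statement (every [K]) together;
    [linearly_controls] expresses this, and the other comparisons have the same
    form:
    - [x] and [y] solve pantograph equations with the same forcing [f], the
      second with coefficients [0] and [-1]; hence the difference of the two
      solves either equation with a forcing built from the other solution
      ([pantograph_transfer], used in both directions);
    - let [I] be an antiderivative of [f], so that
      [f_theta(t) = I(t) - I(t - theta)], and put
      [G(t) = I(t) - (the integral of I over [t-1, t])].  Then [G] is bounded by
      the windows [f_theta(t)], and [y - G] solves [z' = -z - G + f_1]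
      ([ode_of_windows]);
    - conversely [f = y + y'], which bounds the windows by values of [y]
      ([windows_of_ode]).

    These estimates concern bounds uniform in [theta], whereas condition (beta)
    is pointwise in [theta].  A Baire category argument bridges the gap
    ([uniform_window]); applied to [ln gamma(e^u) - eta u] with the constant
    weight 1 it also gives the uniform convergence theorem for regular
    variation.  Part (III) then follows from (I) and (II), because an upper
    limit of [|g| / gamma] is finite iff [g = O(gamma)] and positive iff
    [g = o(gamma)] fails. *)

(** * Uniformity of window estimates via Baire category *)

(** Otherwise the complement of each closed set [F n `&` [0, 1]] would be open
    and dense in the line, and Baire's theorem would produce a point of ]0, 1[
    that lies in no [F n]. *)
Lemma closed_cover_interval (R : realType) (F : nat -> set R) :
  (forall n, closed (F n)) ->
  (forall v : R, 0 <= v <= 1 -> exists n, F n v) ->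
  exists n (c d : R), [/\ 0 <= c, c < d, d <= 1 &
    forall v, c <= v <= d -> F n v].
Proof.
move=> Fcl Fcov.
pose O n : set R := ~` (F n `&` `[0, 1]).
have Oop n : open (O n).
  by apply: closed_openC; apply: closedI => //; exact: itv_closed.
have [n ndense] : exists n, ~ dense (O n).
  apply: contrapT => /forallNP nall.
  have dO n : open (O n) /\ dense (O n) 
    by split=> //; exact: (contrapT (nall n)).
  have [] := @Baire R R^o O dO (`]0, 1[%classic : set R).
  - by exists 2^-1; rewrite /= in_itv /= invr_gt0 ltr0n invf_lt1 ?ltr1n ?ltr0n.
  - exact: itv_open.
  move=> v [+ vO]; rewrite /= in_itv /= => v01.
  have v01' : 0 <= v <= 1 by lra.
  have [n Fv] := Fcov v v01'.
  by apply: (vO n I); split=> //; rewrite /= in_itv.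
move/existsNP: ndense => [D /not_implyP[[v0 Dv0] /not_implyP[Dop DO]]].
have DF v : D v -> F n v /\ 0 <= v <= 1.
  by move=> Dv; apply: contrapT => nF; apply: DO; exists v; split.
have /nbhs_ballP[e /= e0 De] : nbhs v0 D by apply: open_nbhs_nbhs.
have ve : forall v, v0 - e / 2 <= v <= v0 + e / 2 -> D v.
  move=> v hv; apply: De; rewrite -ball_normE /= ltr_norml; move: e0 hv; lra.
exists n, (v0 - e / 2), (v0 + e / 2); split.
- have [|] := DF (v0 - e / 2); last by lra.
  by apply: ve; move: e0; lra.
- by move: e0; lra.
- have [|] := DF (v0 + e / 2); last by lra.
  by apply: ve; move: e0; lra.
- by move=> v /ve/DF[].
Qed.

Lemma near_pinftyP (R : realType) (P : R -> Prop) :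
  (\forall t \near +oo, P t) <-> exists2 T : R, 0 < T & forall t, T <= t -> P t.
Proof.
split.
  move=> [A [_ HA]]; exists (Num.max (A + 1) 1).
    by rewrite lt_max ltr01 orbT.
  by move=> t; rewrite ge_max => /andP[h _]; apply: HA; lra.
by move=> [T T0 HT]; exists T; split=> // [|t /ltW];
  [exact: num_real|exact: HT].
Qed.

Lemma near_pinfty_shift (R : realType) (P : R -> Prop) (k : R) :
  (\forall t \near +oo, P t) -> \forall t \near +oo, P (t - k).
Proof.
move=> [A [Ar HA]]; exists (A + k); split; first exact: num_real.
by move=> t ht; apply: HA; move: ht; lra.
Qed.

Lemma near_pinfty_scale (R : realType) (P : R -> Prop) (q : R) : 0 < q ->
  (\forall t \near +oo, P t) -> \forall t \near +oo, P (q * t).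
Proof.
move=> q0 [A [Ar HA]]; exists (A / q); split; first exact: num_real.
by move=> t ht; apply: HA; move: ht; rewrite ltr_pdivrMr // mulrC.
Qed.

Lemma window_closed (R : realType) (I gamma : R -> R) (e n : R) :
  continuous I ->
  closed [set v | forall t, n <= t -> `|I t - I (t - v)| <= e * gamma t].
Proof.
move=> cI.
have -> : [set v | forall t, n <= t -> `|I t - I (t - v)| <= e * gamma t] =
    \bigcap_(t in [set t | n <= t])
      ((fun v => `|I t - I (t - v)|) @^-1` [set w | w <= e * gamma t]).
  by apply/seteqP; split=> v /= h t; exact: h.
apply: closed_bigI => t _; apply: closed_comp => [v _|]; last exact: closed_le.
apply: (@continuous_comp _ _ _ (fun v => I t - I (t - v)) Num.norm); last first.
  exact: norm_continuous.
apply: continuousB; first exact: cst_continuous.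
apply: (@continuous_comp _ _ _ (fun v => t - v) I); last exact: cI.
by apply: continuousB; [exact: cst_continuous|exact: cvg_id].
Qed.

(** By [closed_cover_interval] the estimate holds, from some time on, for all [v]
    in an interval [[c, d]].  It passes to all small [w] through
    [I t - I (t - w) = (I t - I (t - d)) - (I (t - w) - I ((t - w) - (d - w)))],
    where [d - w] is again in [[c, d]]; anchoring the identity at the right end
    [d] calls only for values of [gamma] at times up to [t], which [C] controls
    even if [gamma] grows arbitrarily fast.  An arbitrary [v] is then a multiple
    of [d - c] plus a small remainder, and there are finitely many multiples. *)
Lemma uniform_window (R : realType) (I gamma : R -> R) (C : R) :
  continuous I -> 1 <= C ->
  (\forall t \near +oo, 0 <= gamma t) ->
  (\forall t \near +oo,
     forall v, 0 <= v <= 1 -> gamma (t - v) <= C * gamma t) ->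
  (forall v e, 0 <= v <= 1 -> 0 < e ->
     \forall t \near +oo, `|I t - I (t - v)| <= e * gamma t) ->
  forall e, 0 < e ->
  \forall t \near +oo, forall v, 0 <= v <= 1 ->
    `|I t - I (t - v)| <= e * gamma t.
Proof.
move=> cI C1 g0 gC Ipt e e0.
(* the errors for the multiple, [e1], and for the remainder at the shifted
   time, [(1 + C) * e1 * C], add up to [e] *)
pose e1 := e / (1 + (1 + C) * C).
have D0 : 0 < 1 + (1 + C) * C by nra.
have e10 : 0 < e1 by rewrite divr_gt0.
have [n [c [d [c0 cd d1 Hn]]]] := @closed_cover_interval R
  (fun n => [set v | forall t, n%:R <= t -> `|I t - I (t - v)| <= e1 * gamma t])
  (fun n => @window_closed R I gamma e1 n%:R cI)
  (fun v hv =>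
    let: ex_intro2 T T0 HT := (near_pinftyP _ _).1 (Ipt v e1 hv e10) in
    ex_intro _ (Num.truncn T).+1
     (fun t ht => HT t (le_trans (ltW (truncnS_gt T)) ht))).
pose dl := d - c.
have dl0 : 0 < dl by rewrite subr_gt0.
have small : \forall t \near +oo, forall w, 0 <= w <= dl ->
    `|I t - I (t - w)| <= (1 + C) * e1 * gamma t.
  near=> t => w wdl.
  have tn : n%:R + 1 <= t by near: t; exact: nbhs_pinfty_ge.
  have h1 : `|I t - I (t - d)| <= e1 * gamma t.
    by apply: Hn; [rewrite lexx ltW|move: tn; lra].
  have h2 : `|I (t - w) - I (t - w - (d - w))| <= e1 * gamma (t - w).
    by apply: Hn; move: wdl tn; rewrite /dl; lra.
  rewrite (_ : t - w - (d - w) = t - d) in h2; last ring.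
  have h3 : gamma (t - w) <= C * gamma t.
    have w01 : 0 <= w <= 1 by move: wdl; rewrite /dl; lra.
    have gCt : forall v, 0 <= v <= 1 -> gamma (t - v) <= C * gamma t by near: t.
    exact: gCt.
  have h4 : `|I t - I (t - w)| <= `|I t - I (t - d)| + `|I (t - w) - I (t - d)|.
    by rewrite (distrC (I (t - w))); apply: ler_distD.
  by have := ler_wpM2l (ltW e10) h3; nra.
have step k : \forall t \near +oo, forall w,
    0 <= w <= dl -> k%:R * dl + w <= 1 ->
    `|I t - I (t - (k%:R * dl + w))| <= e * gamma t.
  have [kd|kd] := leP (k%:R * dl) 1; last first.
    by near=> t => w w0 h; exfalso; lra.
  have k0 : 0 <= k%:R * dl by rewrite mulr_ge0 // ltW.
  have k01 : 0 <= k%:R * dl <= 1 by rewrite k0.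
  have small_k := @near_pinfty_shift _ _ (k%:R * dl) small.
  near=> t => w wdl kw.
  have h1 : `|I t - I (t - k%:R * dl)| <= e1 * gamma t.
    by near: t; exact: Ipt.
  have h2 : `|I (t - k%:R * dl) - I (t - k%:R * dl - w)| <=
            (1 + C) * e1 * gamma (t - k%:R * dl).
    by move: w wdl {kw}; near: t.
  have h3 : gamma (t - k%:R * dl) <= C * gamma t.
    have gCt : forall v, 0 <= v <= 1 -> gamma (t - v) <= C * gamma t by near: t.
    exact: gCt.
  have h4 : 0 <= gamma t by near: t.
  have -> : t - (k%:R * dl + w) = t - k%:R * dl - w by ring.
  apply: (le_trans (ler_distD (I (t - k%:R * dl)) _ _)).
  have e1C : 0 <= (1 + C) * e1 by nra.
  have := ler_wpM2l e1C h3.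
  have -> : e = e1 * (1 + (1 + C) * C) by rewrite /e1 divfK // gt_eqF.
  nra.
have allk (N : nat) : \forall t \near +oo, forall k, (k < N)%N ->
    forall w, 0 <= w <= dl -> k%:R * dl + w <= 1 ->
    `|I t - I (t - (k%:R * dl + w))| <= e * gamma t.
  elim: N => [|N IH]; first by near=> t.
  near=> t => k; rewrite ltnS leq_eqVlt => /orP[/eqP->|kN].
    by near: t; exact: step.
  by move: k kN; near: t.
pose N := (Num.truncn dl^-1).+1.
have HN := allk N.
near=> t => v /andP[v0 v1].
have vd0 : 0 <= v / dl by rewrite divr_ge0 // ltW.
have /andP[kl ku] := truncn_itv vd0.
set k := Num.truncn (v / dl) in kl ku.
have kl' : k%:R * dl <= v by rewrite -ler_pdivlMr.
have ku' : v < k.+1%:R * dl by rewrite -ltr_pdivrMr.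
have kN : (k < N)%N.
  rewrite /N /k ltnS; apply: le_truncn.
  by rewrite ler_pdivrMr // mulVf // gt_eqF.
have -> : v = k%:R * dl + (v - k%:R * dl) by ring.
have Ht : forall k, (k < N)%N ->
    forall w, 0 <= w <= dl -> k%:R * dl + w <= 1 ->
    `|I t - I (t - (k%:R * dl + w))| <= e * gamma t by near: t.
apply: Ht => //; last by rewrite addrC subrK.
move: ku'; rewrite -natr1 mulrDl mul1r => ku'.
by rewrite subr_ge0 kl' /= lerBlDl ltW.
Unshelve. all: by end_near. Qed.

(** * Comparison for the pantograph equation *)

(** The function [e^(-bu) (z u + B/b)] is nonincreasing on [[s, t]]: its
    derivative is [e^(-bu) (h u - B)]. *)
Lemma linear_ode_upper (R : realType) (b B s t : R) (z h : R -> R) :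
  b < 0 -> s <= t ->
  (forall u : R, s <= u <= t -> is_derive u 1 z (b * z u + h u)) ->
  (forall u : R, s <= u <= t -> h u <= B) ->
  z t <= expR (b * (t - s)) * z s + B / - b * (1 - expR (b * (t - s))).
Proof.
move=> b0 st dz hB.
pose phi (u : R) : R := expR (- b * u) * (z u + B / b).
have dphi u : s <= u <= t -> is_derive u 1 phi (expR (- b * u) * (h u - B)).
  move=> hu; have dzu := dz u hu.
  apply: is_derive_eq.
  rewrite /GRing.scale /=; field.
  by rewrite lt_eqF.
have oo_cc u : u \in `]s, t[ -> s <= u <= t.
  by rewrite in_itv /= => /andP[su ut]; rewrite (ltW su) (ltW ut).
have phile : phi t <= phi s.
  have [ss tt] : s \in `[s, t] /\ t \in `[s, t] by rewrite !in_itv /= !lexx st.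
  have phi_derivable u : u \in `]s, t[ -> derivable phi u 1.
    by move=> /oo_cc/dphi d; exact: ex_derive.
  have phi'_le0 u : u \in `]s, t[ -> derive1 phi u <= 0.
    move=> /oo_cc hu; have d := dphi u hu; rewrite derive1E derive_val.
    by apply: mulr_ge0_le0; [exact: expR_ge0|rewrite subr_le0; exact: hB].
  have phi_cont : {within `[s, t], continuous phi}.
    apply: derivable_within_continuous => u; rewrite in_itv /= => hu.
    by have d := dphi u hu; exact: ex_derive.
  exact: (@ler0_derive1_le_cc R phi s t phi_derivable phi'_le0 phi_cont).
have E : expR (b * (t - s)) = expR (b * t) * expR (- b * s).
  by rewrite -expRD; congr expR; ring.
have Et : expR (b * t) * expR (- b * t) = 1 by rewrite mulNr expRxMexpNx_1.
have := ler_wpM2l (expR_ge0 (b * t)) phile.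
rewrite /phi !mulrA Et mul1r -E => H.
have -> : B / - b = - (B / b) by rewrite invrN mulrN.
move: H; set w := B / b; lra.
Qed.

Lemma linear_ode_bound (R : realType) (b B s t : R) (z h : R -> R) :
  b < 0 -> s <= t ->
  (forall u : R, s <= u <= t -> is_derive u 1 z (b * z u + h u)) ->
  (forall u : R, s <= u <= t -> `|h u| <= B) ->
  `|z t| <= expR (b * (t - s)) * `|z s| + B / - b * (1 - expR (b * (t - s))).
Proof.
move=> b0 st dz hB.
have e0 := expR_ge0 (b * (t - s)).
have up : z t <= expR (b * (t - s)) * z s + B / - b * (1 - expR (b * (t - s))).
  apply: (linear_ode_upper _ _ _ _ _ _ _ b0 st dz) => u hu.
  exact: le_trans (ler_norm _) (hB u hu).
have down : - z t <=
    expR (b * (t - s)) * - z s + B / - b * (1 - expR (b * (t - s))).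
  apply: (linear_ode_upper _ _ _ _ _ (fun u => - z u) (fun u => - h u) b0 st)
    => u hu.
    have d := dz u hu; apply: is_derive_eq; ring.
  by rewrite lerNl; have := hB u hu; rewrite ler_norml => /andP[].
have h1 := ler_wpM2l e0 (ler_norm (z s)).
have h2 := ler_wpM2l e0 (ler_norm (- z s)).
rewrite normrN in h2.
by rewrite ler_norml; apply/andP; split; lra.
Qed.

Lemma bounded_ratio (R : realType) (z gamma : R -> R) (A B : R) :
  (forall t : R, A <= t <= B -> {for t, continuous z}) ->
  (forall t : R, A <= t <= B -> {for t, continuous gamma}) ->
  (forall t : R, A <= t <= B -> 0 < gamma t) ->
  exists2 M : R, 0 < M & forall t : R, A <= t <= B -> `|z t| <= M * gamma t.
Proof.
move=> cz cg g0.
have [AB|BA] := leP A B; last by exists 1 => // t; lra.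
have [|c cAB Hc] := @EVT_max R (fun t => `|z t| / gamma t) A B AB.
  apply: continuous_in_subspaceT => t; rewrite inE /= in_itv /= => tAB.
  apply: (@continuousM _ _ (fun t => `|z t|) (fun t => (gamma t)^-1)).
    apply: (@continuous_comp _ _ _ z Num.norm); first exact: cz.
    exact: norm_continuous.
  by apply: continuousV; [rewrite gt_eqF // g0|exact: cg].
exists (`|z c| / gamma c + 1).
  have : 0 < gamma c by apply: g0; move: cAB; rewrite in_itv.
  by move=> gc; rewrite ltr_wpDl // divr_ge0 // ltW.
move=> t tAB; have g0t := g0 t tAB.
rewrite -ler_pdivrMr //; apply: (@le_trans _ _ (`|z c| / gamma c)).
  by apply: Hc; rewrite in_itv.
by rewrite lerDl.
Qed.

(** Only the decrease of [gamma] is limited: it may increase arbitrarily fast. *)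
Definition slowly_decreasing (R : realType) (gamma : R -> R) : Prop :=
  forall e, 0 < e -> \forall t \near +oo,
    forall v : R, 0 <= v <= 1 -> gamma (t - v) <= (1 + e) * gamma t.

(** The equation without its delayed term is integrated over [[t - 1, t]] with
    the forcing [a z(qu) + g u].  Up to the factor [1 + eps] that the shifts of
    [gamma] cost, the coefficient of [M] is the average of 1 and [|a| L / |b|]
    with weights [e^b] and [1 - e^b], so it is below 1 if [|a| L < |b|] and [eps]
    is small. *)
Lemma unit_step_bound (R : realType) (q a b L M K eps t : R)
    (z g gamma : R -> R) :
  b < 0 -> 0 <= L -> 0 <= M -> 0 <= K ->
  (forall v : R, 0 <= v <= 1 -> gamma (t - v) <= (1 + eps) * gamma t) ->
  (forall u : R, t - 1 <= u <= t -> gamma (q * u) <= L * gamma u) ->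
  (forall u : R, t - 1 <= u <= t ->
     is_derive u 1 z (a * z (q * u) + b * z u + g u)) ->
  (forall u : R, t - 1 <= u <= t -> `|g u| <= K * gamma u) ->
  `|z (t - 1)| <= M * gamma (t - 1) ->
  (forall u : R, t - 1 <= u <= t -> `|z (q * u)| <= M * gamma (q * u)) ->
  `|z t| <= ((1 + eps) * (expR b + (1 - expR b) * (`|a| * L / - b)) * M +
             (1 + eps) * ((1 - expR b) / - b) * K) * gamma t.
Proof.
move=> b0 L0 M0 K0 gv gq dz gK z1 zq.
have st : t - 1 <= t by rewrite lerBlDr lerDl.
have dz' u : t - 1 <= u <= t ->
    is_derive u 1 z (b * z u + (a * z (q * u) + g u)).
  by move=> hu; have d := dz u hu; apply: is_derive_eq; ring.
have aML0 : 0 <= `|a| * M * L + K by rewrite addr_ge0 ?mulr_ge0.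
have forcing u : t - 1 <= u <= t ->
    `|a * z (q * u) + g u| <= (`|a| * M * L + K) * ((1 + eps) * gamma t).
  move=> hu; apply: (le_trans (ler_normD _ _)); rewrite normrM.
  have gut : gamma u <= (1 + eps) * gamma t.
    by rewrite -(subKr t u); apply: gv; move: hu; clear; lra.
  apply: le_trans (ler_wpM2l aML0 gut); rewrite mulrDl -!mulrA.
  apply: lerD (gK u hu); apply: ler_wpM2l => //.
  by apply: (le_trans (zq u hu)); apply: ler_wpM2l => //; exact: gq.
have := linear_ode_bound R b _ (t - 1) t z _ b0 st dz' forcing.
rewrite subKr mulr1 => /le_trans; apply.
have z1' : `|z (t - 1)| <= M * ((1 + eps) * gamma t).
  apply: (le_trans z1); apply: ler_wpM2l => //.
  by apply: gv; rewrite ler01 lexx.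
apply: (le_trans (lerD (ler_wpM2l (expR_ge0 b) z1') (lexx _))).
rewrite le_eqVlt; apply/orP; left; apply/eqP; field.
by rewrite lt_eqF.
Qed.

(** An induction over unit intervals first shows that [|z| / gamma] is bounded:
    the estimate at [t] relies on times up to [t - 1] only, so each interval is
    controlled by the earlier ones.  Iterating [M |-> r M + c] then brings the
    bound below any number above the fixed point [d = c / (1 - r)], such as
    [2 d]. *)
Lemma delayed_contraction (R : realType) (q r c T : R) (z gamma : R -> R) :
  0 < q < 1 -> 0 < r < 1 -> 0 < c -> 0 < T ->
  (forall t : R, T <= t -> 0 < gamma t) ->
  (forall t : R, T <= t -> {for t, continuous gamma}) ->
  (forall t : R, T <= t -> {for t, continuous z}) ->
  (forall M t : R, 0 <= M -> T <= t ->
     (forall s : R, q * (t - 1) <= s <= t - 1 -> `|z s| <= M * gamma s) ->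
     `|z t| <= (r * M + c) * gamma t) ->
  \forall t \near +oo, `|z t| <= 2 * (c / (1 - r)) * gamma t.
Proof.
move=> /andP[q0 q1] /andP[r0 r1] c0 T0 g0 cg cz step.
have s0 : 0 < 1 - r by rewrite subr_gt0.
have [d d0 dE] : exists2 d : R, 0 < d & c = (1 - r) * d.
  by exists (c / (1 - r)); [exact: divr_gt0|rewrite mulrC divfK // lt0r_neq0].
rewrite dE in step *; rewrite [_ * d]mulrC mulfK; last exact: lt0r_neq0.
have gle (A B t : R) : T <= t -> A <= B -> A * gamma t <= B * gamma t.
  by move=> tT AB; apply: ler_wpM2r => //; apply/ltW/g0.
have Tq : T <= T / q by rewrite ler_pdivlMr // ler_piMr // ltW.
have [M0 M00 HM0] : exists2 M : R, 0 < M & forall t : R, T <= t <= T / q + 1 ->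
    `|z t| <= M * gamma t.
  by apply: bounded_ratio => t /andP[tT _]; [exact: cz|exact: cg|exact: g0].
have [M [M_gt0 M0M dM]] : exists M : R, [/\ 0 < M, M0 <= M & d <= M].
  by exists (Num.max M0 d); rewrite lt_max M00 !le_max !lexx orbT.
(* beyond [T / q + 1] the delayed times [q * (t - 1)] are past [T] *)
have bdd n : forall t : R, T <= t <= T / q + 1 + n%:R -> `|z t| <= M * gamma t.
  elim: n => [|n IH] t /andP[tT tn1].
    apply: (le_trans (HM0 t _)); last exact: gle.
    by rewrite tT /=; move: tn1; rewrite addr0.
  have [tn|tn] := leP t (T / q + 1 + n%:R); first by apply: IH; rewrite tT.
  have hq : T <= q * (t - 1).
    rewrite mulrC -ler_pdivrMr //.
    by have := ler0n R n; move: tn; clear; lra.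
  have : `|z t| <= (r * M + (1 - r) * d) * gamma t.
    apply: step => //; first exact: ltW.
    move=> s /andP[s1 s2]; apply: IH; rewrite (le_trans hq s1) /=.
    by move: s2 tn1; rewrite -natr1; clear; lra.
  move/le_trans; apply; apply: gle => //.
  have : (1 - r) * d <= (1 - r) * M by apply: ler_wpM2l => //; exact: ltW.
  by clear; lra.
have bddT (t : R) : T <= t -> `|z t| <= M * gamma t.
  move=> tT; apply: (bdd (Num.truncn t).+1); rewrite tT /=.
  by have := truncnS_gt t; move: T0 Tq; clear; lra.
(* each use of the contraction pushes the starting time from [T'] to
   [T' / q + 1] *)
have iter n : \forall t \near +oo, `|z t| <= (r ^+ n * M + d) * gamma t.
  elim: n => [|n IH].
    near=> t.
    have tT : T <= t by near: t; apply: nbhs_pinfty_ge; exact: num_real.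
    apply: (le_trans (bddT t tT)); apply: gle => //.
    by rewrite expr0 mul1r lerDl ltW.
  have [T' T'0 HT'] := (near_pinftyP _ _).1 IH.
  near=> t.
  rewrite (_ : r ^+ n.+1 * M + d = r * (r ^+ n * M + d) + (1 - r) * d).
    apply: step.
    - apply: addr_ge0; last exact: ltW.
      by apply: mulr_ge0; [apply: exprn_ge0|]; exact: ltW.
    - by near: t; apply: nbhs_pinfty_ge; exact: num_real.
    - move=> s /andP[hs _]; apply: HT'; apply: le_trans hs.
      rewrite mulrC -ler_pdivrMr // lerBrDr.
      by near: t; apply: nbhs_pinfty_ge; exact: num_real.
  by rewrite exprS; ring.
have [n rn] : exists n, r ^+ n * M <= d.
  have cv : (fun n => r ^+ n) @ \oo --> (0 : R).
    have r1' : `|r| < 1 by rewrite ger0_norm // ltW.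
    exact: cvg_expr.
  have dM0 : 0 < d / M by exact: divr_gt0.
  have [N _ HN] : \forall n \near \oo, `|0 - r ^+ n| <= d / M.
    by move/cvgrPdist_le: cv; exact.
  exists N; have := HN N (leqnn N).
  rewrite /= sub0r normrN ger0_norm; last by apply: exprn_ge0; exact: ltW.
  by rewrite ler_pdivlMr.
near=> t.
have tT : T <= t by near: t; apply: nbhs_pinfty_ge; exact: num_real.
have : `|z t| <= (r ^+ n * M + d) * gamma t by near: t; exact: iter.
move/le_trans; apply; apply: gle => //.
by rewrite mulr_natl mulr2n lerD.
Unshelve. all: by end_near. Qed.

(** The constant [C] is chosen before [K], [z] and [g]: initial values influence
    only the time from which the bound holds. *)
Lemma pantograph_comparison (R : realType) (q a b L : R) (gamma : R -> R) :
  0 < q < 1 -> b < 0 -> 0 <= L -> `|a| * L < - b ->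
  (forall t : R, 0 < t -> 0 < gamma t) ->
  (forall t : R, 0 < t -> {for t, continuous gamma}) ->
  slowly_decreasing R gamma ->
  (\forall t \near +oo, gamma (q * t) <= L * gamma t) ->
  exists2 C : R, 0 < C & forall (K : R) (z g : R -> R), 0 < K ->
    (\forall t \near +oo,
       is_derive (t : R) (1 : R) z (a * z (q * t) + b * z t + g t)) ->
    (\forall t \near +oo, `|g t| <= K * gamma t) ->
    \forall t \near +oo, `|z t| <= C * K * gamma t.
Proof.
move=> q01 b0 L0 aL g0 cg sd gq; have /andP[q0 q1] := q01.
have e0 : 0 < expR b := expR_gt0 b.
have e1 : expR b < 1 by rewrite expR_lt1.
have nb0 : 0 < - b by rewrite oppr_gt0.
have [eps [r [C1 [eps0 r01 C10 rE C1E]]]] : exists eps r C1 : R,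
    [/\ 0 < eps, 0 < r < 1, 0 < C1,
        (1 + eps) * (expR b + (1 - expR b) * (`|a| * L / - b)) = r &
        (1 + eps) * ((1 - expR b) / - b) = C1].
  have k1 : `|a| * L / - b < 1 by rewrite ltr_pdivrMr // mul1r.
  have k0 : 0 <= `|a| * L / - b by rewrite divr_ge0 ?mulr_ge0 // ltW.
  have m0 : 0 < (1 - expR b) / - b by rewrite divr_gt0 // subr_gt0.
  move: (expR b) (`|a| * L / - b) ((1 - expR b) / - b) e0 e1 k0 k1 m0.
  clear=> e k m e0 e1 k0 k1 m0.
  have r00 : 0 < e + (1 - e) * k by nra.
  have r01 : e + (1 - e) * k < 1 by nra.
  exists ((1 - (e + (1 - e) * k)) / 2).
  move: (e + (1 - e) * k) r00 r01; clear - m0 => r0 r00 r01.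
  by do 2 eexists; split; [..|reflexivity|reflexivity];
    [lra|apply/andP; split; nra|apply: mulr_gt0 => //; lra].
have r10 : 0 < 1 - r by case/andP: r01; rewrite subr_gt0.
exists (2 * (C1 / (1 - r))); first by rewrite mulr_gt0 // divr_gt0.
move=> K z g K0 dz gK.
have [T T0 HT] : exists2 T : R, 0 < T & forall t : R, T <= t -> [/\
    forall v : R, 0 <= v <= 1 -> gamma (t - v) <= (1 + eps) * gamma t,
    gamma (q * t) <= L * gamma t,
    is_derive t 1 z (a * z (q * t) + b * z t + g t) &
    `|g t| <= K * gamma t].
  apply/near_pinftyP; near=> t; split; near: t => //; exact: sd.
rewrite (_ : 2 * _ * K = 2 * (C1 * K / (1 - r))); last first.
  by rewrite -!mulrA [(1 - r)^-1 * K]mulrC.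
have [T1 [T1_gt0 T1T T1q]] : exists T1 : R, [/\ 0 < T1, T + 1 <= T1 &
    forall t : R, T1 <= t -> q * t <= t - 1].
  exists (Num.max (T + 1) (1 - q)^-1); split.
  - by rewrite lt_max addr_gt0.
  - by rewrite le_max lexx.
  move=> t; rewrite ge_max => /andP[_].
  rewrite -[_^-1]mul1r ler_pdivrMr ?subr_gt0 //; clear; lra.
have ge0 (t : R) : T1 <= t -> 0 < t by exact: lt_le_trans.
apply: (@delayed_contraction R q r (C1 * K) T1) => //.
- exact: mulr_gt0.
- by move=> t /ge0; exact: g0.
- by move=> t /ge0; exact: cg.
- move=> t tT; have [|_ _ d _] := HT t; first by move: T1T tT; clear; lra.
  by apply: differentiable_continuous; apply/derivable1_diffP; exact: ex_derive.
move=> M t M0 tT zM.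
have tT1 : T <= t - 1 by move: T1T tT; clear; lra.
have tT' : T <= t by move: tT1; clear; lra.
have HTu u : t - 1 <= u <= t -> T <= u.
  by move=> /andP[+ _]; exact: le_trans.
have qt1 : q * t <= t - 1 := T1q t tT.
have tt1 : q * (t - 1) <= t - 1.
  by rewrite ler_piMl ?ltW // (lt_le_trans T0).
rewrite -rE -C1E.
apply: (@unit_step_bound R q a b L M K eps t z g) => //; first exact: ltW.
- by have [] := HT t tT'.
- by move=> u /HTu/HT[].
- by move=> u /HTu/HT[].
- by move=> u /HTu/HT[].
- by apply: zM; rewrite tt1 lexx.
- move=> u /andP[u1 u2]; apply: zM.
  apply/andP; split; first exact: ler_wpM2l (ltW q0) _ _ u1.
  exact: le_trans (ler_wpM2l (ltW q0) u2) qt1.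
Unshelve. all: by end_near. Qed.

(** * Weights: increasing and regularly varying *)

Lemma halfline_extension_continuous (R : realType) (g : R -> R) :
  continuous_halfline g -> continuous (fun t : R => g (Num.max t 0)).
Proof.
move=> /subspace_continuousP cg t.
have m0 : `[0, +oo[%classic (Num.max t 0).
  by rewrite /= in_itv /= andbT le_max lexx orbT.
have cm : Num.max s 0 @[s --> t] --> Num.max t 0.
  by apply: (@continuous_max _ _ (fun s : R => s) (fun=> 0));
    [exact: cvg_id|exact: cvg_cst].
apply: cvg_trans (cg _ m0) => P /= HP.
have := cm _ HP; rewrite /= !nbhs_simpl /=; apply: filterS => s; apply.
by rewrite /= in_itv /= andbT le_max lexx orbT.
Qed.

Lemma halfline_continuous_at (R : realType) (g : R -> R) (t : R) :
  continuous_halfline g -> 0 < t -> {for t, continuous g}.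
Proof.
move=> /halfline_extension_continuous cg t0.
have := cg t; rewrite /continuous_at max_l; last exact: ltW.
apply: cvg_trans; apply: near_eq_cvg.
by near=> s; rewrite max_l // ltW //; near: s; exact: lt_nbhsr.
Unshelve. all: by end_near. Qed.

Lemma nondecreasing_slowly_decreasing (R : realType) (gamma : R -> R) :
  (forall t : R, 0 <= t -> 0 < gamma t) ->
  (forall s t : R, 0 <= s -> s <= t -> gamma s <= gamma t) ->
  slowly_decreasing R gamma.
Proof.
move=> g0 gmono e e0; near=> t => v v01.
have t1 : 1 <= t by near: t; apply: nbhs_pinfty_ge; exact: num_real.
have gt0 : 0 < gamma t by apply: g0; lra.
have : gamma (t - v) <= gamma t by apply: gmono; lra.
move/le_trans; apply; nra.
Unshelve. all: by end_near. Qed.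

Lemma near_expR_pinfty (R : realType) (P : R -> Prop) :
  (\forall t \near +oo, P t) -> \forall u \near +oo, P (expR u).
Proof.
move=> /near_pinftyP[T T0 HT]; near=> u; apply: HT.
apply: le_trans (expR_ge1Dx u); rewrite -lerBlDl.
by near: u; apply: nbhs_pinfty_ge; exact: num_real.
Unshelve. all: by end_near. Qed.

(** The uniform convergence theorem for regular variation, in logarithmic
    coordinates: [gamma (lambda t) / gamma t --> lambda^eta] says that the
    increments of [h] over a fixed shift tend to 0, and [uniform_window] with the
    constant weight 1 makes this uniform over shifts in [0, 1]. *)
Lemma regularly_varying_log_uniform (R : realType) (eta : R) (gamma : R -> R) :
  continuous_halfline gamma -> regularly_varying eta gamma ->
  let h u := ln (gamma (expR u)) - eta * u in
  forall e, 0 < e ->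
  \forall u \near +oo, forall v, 0 <= v <= 1 -> `|h u - h (u - v)| <= e.
Proof.
move=> cg [_ g0 rv] h e e0.
have ge0 u : 0 < gamma (expR u) by apply/g0/expR_ge0.
suff : \forall u \near +oo, forall v, 0 <= v <= 1 ->
    `|h u - h (u - v)| <= e * 1.
  by apply: filterS => u H v /H; rewrite mulr1.
apply: (@uniform_window R h (fun=> 1) 1) => //.
- move=> u; apply: (@continuousB _ _ _ (fun u => ln (gamma (expR u)))
      (fun u => eta * u)).
    apply: (@continuous_comp _ _ _ (fun u => gamma (expR u)) (@ln R)).
      apply: (@continuous_comp _ _ _ (@expR R) gamma).
        exact: continuous_expR.
      by apply: halfline_continuous_at => //; exact: expR_gt0.
    exact: continuous_ln.
  apply: (@continuousM _ _ (fun=> eta) (fun u : R => u));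
    [exact: cvg_cst|exact: cvg_id].
- exact: nearW.
- by near=> t => v _; rewrite mul1r.
move=> v d _ d0.
have rvv := rv (expR (- v)) (expR_gt0 _).
have cl : ln (gamma (expR (- v) * t) / gamma t) @[t --> +oo] -->
    ln (expR (- v) `^ eta).
  apply: (cvg_comp _ (@ln R) rvv).
  by apply: continuous_ln; rewrite powR_gt0 // expR_gt0.
have lnE : ln (expR (- v) `^ eta) = - (eta * v).
  by rewrite ln_powR expRK mulrN.
rewrite lnE in cl.
have /near_expR_pinfty : \forall t \near +oo,
    `|- (eta * v) - ln (gamma (expR (- v) * t) / gamma t)| <= d.
  by move/cvgrPdist_le: cl; exact.
apply: filterS => u; rewrite -expRD (addrC (- v)) mulr1 /h => H.
have gv := ge0 (u - v); have gu := ge0 u.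
move: H; rewrite lnM ?posrE ?invr_gt0 // lnV ?posrE //.
rewrite (_ : - (eta * v) - _ =
  ln (gamma (expR u)) - eta * u -
    (ln (gamma (expR (u - v))) - eta * (u - v))) //.
ring.
Unshelve. all: by end_near. Qed.

(** A shift of [t] by [v <= 1] is a shift of [ln t] by [w = ln t - ln (t - v)],
    which tends to 0.  In logarithmic coordinates the increment of [ln gamma] is
    then at most [l / 2], by uniform convergence, plus [|eta| w <= l / 2], where
    [l = ln (1 + e)]. *)
Lemma regularly_varying_slowly_decreasing (R : realType) (eta : R)
    (gamma : R -> R) :
  continuous_halfline gamma -> regularly_varying eta gamma ->
  slowly_decreasing R gamma.
Proof.
move=> cg rv e e0.
have [_ g0 _] := rv.
pose l := ln (1 + e).
have l0 : 0 < l by rewrite ln_gt0 // ltrDl.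
have lE : expR l = 1 + e by rewrite lnK // posrE; lra.
have l20 : 0 < l / 2 by lra.
have Hu := @regularly_varying_log_uniform R eta gamma cg rv _ l20.
have [U U0 HU] := (near_pinftyP _ _).1 Hu.
(* shifts [w <= m] of the logarithm change [eta * w] by at most [l / 2] *)
pose m := Num.min (l / (2 * (`|eta| + 1))) 1.
have eta1 : 0 < `|eta| + 1 by rewrite ltr_wpDl.
have m0 : 0 < m by rewrite /m lt_min ltr01 andbT divr_gt0 // mulr_gt0.
have m1 : m <= 1 by rewrite /m ge_min lexx orbT.
have ml : m * (`|eta| + 1) <= l / 2.
  have : m <= l / (2 * (`|eta| + 1)) by rewrite /m ge_min lexx.
  by rewrite invfM mulrA -ler_pdivrMr ?invr_gt0 // invrK.
have em1 : expR (- m) < 1 by rewrite expR_lt1 oppr_lt0.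
near=> t => v /andP[v0 v1].
have t1 : 2 <= t by near: t; apply: nbhs_pinfty_ge; exact: num_real.
have tU : expR U <= t by near: t; apply: nbhs_pinfty_ge; exact: num_real.
have tm : (1 - expR (- m))^-1 <= t.
  by near: t; apply: nbhs_pinfty_ge; exact: num_real.
have t0 : 0 < t by lra.
have tv0 : 0 < t - v by lra.
pose u := ln t.
have tE : t = expR u by rewrite lnK.
pose w := u - ln (t - v).
have tvE : t - v = expR (u - w) by rewrite /w subKr lnK.
have w0 : 0 <= w by rewrite subr_ge0 ler_ln ?posrE //; lra.
(* [t >= 1 / (1 - e^(-m))] gives [e^(-m) t <= t - 1], hence [w <= m] *)
have wm : w <= m.
  have : expR (- m) * t <= t - v.
    move: tm; rewrite -[_^-1]mul1r ler_pdivrMr ?subr_gt0 //; lra.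
  rewrite tvE {1}tE -expRD ler_expR; lra.
have w1 : 0 <= w <= 1 by lra.
have uU : U <= u by rewrite -ler_expR -tE.
have := HU u uU w w1; rewrite -tE -tvE ler_norml => /andP[H _].
have gt0 : 0 < gamma t by apply: g0; lra.
have gtv0 : 0 < gamma (t - v) by apply: g0; lra.
have etaw : - (eta * w) <= `|eta| * m.
  apply: (le_trans (ler_norm _)); rewrite normrN normrM (ger0_norm w0).
  exact: ler_wpM2l.
have Hl : ln (gamma (t - v)) <= l + ln (gamma t) by lra.
rewrite -(@lnK _ (gamma (t - v))) ?posrE // -lE -(@lnK _ (gamma t)) ?posrE //.
by rewrite -expRD ler_expR.
Unshelve. all: by end_near. Qed.

(** [gamma (q t) / gamma t] tends to [q^eta], and [q^eta < |b| / |a|] is the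
    hypothesis on [eta] after taking logarithms, [ln q] being negative. *)
Lemma regularly_varying_scale (R : realType) (q a b eta : R) (gamma : R -> R) :
  0 < q < 1 -> a != 0 -> b < 0 ->
  - (ln `|b / a| / ln (1 / q)) < eta -> regularly_varying eta gamma ->
  exists L : R, [/\ 0 <= L, `|a| * L < - b &
    \forall t \near +oo, gamma (q * t) <= L * gamma t].
Proof.
move=> /andP[q0 q1] a0 b0 keta [_ g0 rv].
have na0 : 0 < `|a| by rewrite normr_gt0.
have nb0 : 0 < - b by rewrite oppr_gt0.
have ba : `|b / a| = - b / `|a| by rewrite normrM normfV ltr0_norm.
have lq : ln q < 0 by rewrite ln_lt0 // q0.
have qe : q `^ eta < - b / `|a|.
  rewrite -ltr_ln ?posrE ?powR_gt0 ?divr_gt0 // ln_powR.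
  move: keta; rewrite ba mul1r lnV ?posrE // invrN mulrN opprK.
  by rewrite ltr_ndivrMr.
pose L := (q `^ eta + - b / `|a|) / 2.
have qe0 := powR_ge0 q eta.
exists L; split.
- by rewrite /L; lra.
- rewrite mulrC -ltr_pdivlMr // /L; lra.
have qL : q `^ eta < L by rewrite /L; lra.
near=> t.
have t0 : 0 < t by near: t; apply: nbhs_pinfty_gt; exact: num_real.
have gt0 : 0 < gamma t by apply: g0; lra.
rewrite -ler_pdivrMr // ltW //; near: t.
exact: (cvgr_lt _ (rv q q0) _ qL).
Unshelve. all: by end_near. Qed.

(** * Windows as increments of an antiderivative *)

(** The function [I] is an integral of [f] frozen at negative arguments at its
    value at 0, and is itself frozen there; this makes [I] continuous on the
    whole line and matches the truncation [max (t - theta) 0] in the windows. *)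
Lemma window_antiderivative (R : realType) (f : R -> R) :
  continuous_halfline f ->
  exists I : R -> R, [/\ continuous I,
    forall t : R, 0 < t -> is_derive t 1 I (f t) &
    forall t v : R, 0 <= t -> 0 <= v ->
      window_integral f v t = I t - I (t - v)].
Proof.
move=> cf.
pose F (t : R) := f (Num.max t 0).
have cF : continuous F := @halfline_extension_continuous R f cf.
pose J (x : R) : R := \int[@lebesgue_measure R]_(s in `[-1, x]) F s.
(* integrating from -1 makes 0 an interior point for the fundamental theorem *)
have dJ (x : R) : -1 < x -> is_derive x 1 J (F x).
  move=> x1.
  have xx1 : x < x + 1 by rewrite ltrDl.
  have iF : (@lebesgue_measure R).-integrable `[-1, x + 1] (EFin \o F).
    apply: continuous_compact_integrable; first exact: segment_compact.
    exact: continuous_subspaceT.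
  have [dx <-] := @continuous_FTC1_closed R F (-1) x (x + 1) xx1 iF x1 (cF x).
  by rewrite derive1E; apply: derivableP.
have cJ (x : R) : -1 < x -> {for x, continuous J}.
  move=> x1; have d := dJ x x1.
  by apply: differentiable_continuous; apply/derivable1_diffP; exact: ex_derive.
exists (fun t => J (Num.max t 0)); split.
- move=> t; apply: (@continuous_comp R R R (fun t => Num.max t 0) J).
    by apply: (@continuous_max _ _ (fun s : R => s) (fun=> 0));
      [exact: cvg_id|exact: cvg_cst].
  by apply: cJ; rewrite lt_max; apply/orP; right; lra.
- move=> t t0.
  have -> : f t = F t by rewrite /F max_l // ltW.
  have d : is_derive t 1 J (F t) by apply: dJ; lra.
  apply: near_eq_is_derive d.
  by near=> s; rewrite max_l // ltW //; near: s; exact: lt_nbhsr.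
- move=> t v t0 v0; rewrite /window_integral.
  set A := Num.max (t - v) 0.
  have A0 : 0 <= A by rewrite le_max lexx orbT.
  have At : A <= t by rewrite ge_max t0 andbT; lra.
  rewrite (max_l t0).
  move: At; rewrite le_eqVlt => /orP[/eqP <-|At].
    by rewrite set_itv1 Rintegral_set1 subrr.
  rewrite /Rintegral (@continuous_FTC2 R f J A t At) //.
  + apply: continuous_subspaceW cf => s /=.
    rewrite !in_itv /= andbT => /andP[+ _].
    exact: le_trans.
  + split.
    * move=> x; rewrite in_itv /= => /andP[Ax _].
      have d : is_derive x 1 J (F x) by apply: dJ; lra.
      exact: ex_derive.
    * by apply: cvg_at_right_filter; apply: cJ; lra.
    * by apply: cvg_at_left_filter; apply: cJ; lra.
  + move=> x; rewrite in_itv /= => /andP[Ax _].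
    have d : is_derive x 1 J (F x) by apply: dJ; lra.
    by rewrite derive1E derive_val /F max_l //; lra.
Unshelve. all: by end_near. Qed.

(** * Transfer of bounds between windows and solutions *)

Definition eventually_le (R : realType) (gamma : R -> R) (K : R) (g : R -> R) :=
  \forall t \near +oo, `|g t| <= K * gamma t.

Definition windows_eventually_le (R : realType) (f gamma : R -> R) (K : R) :=
  \forall t \near +oo, forall v, 0 <= v <= 1 ->
    `|window_integral f v t| <= K * gamma t.

Definition tame (R : realType) (q L : R) (gamma : R -> R) : Prop :=
  [/\ forall t : R, 0 <= t -> 0 < gamma t,
      continuous_halfline gamma,
      slowly_decreasing R gamma &
      \forall t \near +oo, gamma (q * t) <= L * gamma t].

(** The constant [C] does not depend on [K]: this is what lets one implication
    serve for big-O (quantify [K] existentially) and for little-o (quantify it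
    universally). *)
Definition linearly_controls (R : realType) (P Q : R -> Prop) : Prop :=
  exists2 C : R, 0 < C & forall K : R, 0 < K -> P K -> Q (C * K).

Lemma linearly_controls_ex (R : realType) (P Q : R -> Prop) :
  linearly_controls R P Q -> (exists2 K, 0 < K & P K) -> exists2 K, 0 < K & Q K.
Proof.
by move=> [C C0 PQ] [K K0 PK]; exists (C * K); [exact: mulr_gt0|exact: PQ].
Qed.

Lemma linearly_controls_all (R : realType) (P Q : R -> Prop) :
  linearly_controls R P Q -> (forall K, 0 < K -> P K) -> forall K, 0 < K -> Q K.
Proof.
move=> [C C0 PQ] PK K K0.
have KC : 0 < K / C by rewrite divr_gt0.
by rewrite -(divfK (lt0r_neq0 C0) K) mulrC; apply: PQ => //; exact: PK.
Qed.

(** The difference [w - u] solves the equation of [w] with the forcing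
    [(a2 - a1) u(qt) + (b2 - b1) u t] in place of [phi], and this forcing is
    bounded by a multiple of [K gamma]. *)
Lemma pantograph_transfer (R : realType) (q L a1 b1 a2 b2 : R)
    (gamma phi u w : R -> R) :
  0 < q < 1 -> 0 <= L -> b2 < 0 -> `|a2| * L < - b2 -> tame R q L gamma ->
  (forall t : R, 0 < t ->
     is_derive t 1 u (a1 * u (q * t) + b1 * u t + phi t)) ->
  (forall t : R, 0 < t ->
     is_derive t 1 w (a2 * w (q * t) + b2 * w t + phi t)) ->
  linearly_controls R (fun K => eventually_le R gamma K u)
    (fun K => eventually_le R gamma K w).
Proof.
move=> q01 L0 b20 a2L [g0 cg sd gq] du dw.
have [q0 q1] := andP q01.
have g0' (t : R) : 0 < t -> 0 < gamma t by move=> t0; apply: g0; exact: ltW.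
have cg' (t : R) : 0 < t -> {for t, continuous gamma}.
  by move=> t0; exact: halfline_continuous_at.
have [C C0 HC] :=
  @pantograph_comparison R q a2 b2 L gamma q01 b20 L0 a2L g0' cg' sd gq.
pose D := `|a2 - a1| * L + `|b2 - b1| + 1.
have D0 : 0 < D by rewrite /D ltr_wpDl // addr_ge0 // mulr_ge0.
exists (C * D + 1); first by rewrite addr_gt0 // mulr_gt0.
move=> K K0 uK.
have uKq := near_pinfty_scale R _ q q0 uK.
have zK : eventually_le R gamma (C * (D * K)) (fun t => w t - u t).
  apply: (HC _ _ (fun t => (a2 - a1) * u (q * t) + (b2 - b1) * u t)).
  - by rewrite mulr_gt0.
  - near=> t.
    have t0 : 0 < t by near: t; apply: nbhs_pinfty_gt; exact: num_real.
    have d1 := du t t0; have d2 := dw t t0.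
    by apply: is_derive_eq; ring.
  - near=> t.
    have t0 : 0 < t by near: t; apply: nbhs_pinfty_gt; exact: num_real.
    have gt0 := g0' t t0.
    have h1 : `|u t| <= K * gamma t by near: t.
    have h2 : `|u (q * t)| <= K * gamma (q * t) by near: t.
    have h3 : gamma (q * t) <= L * gamma t by near: t.
    apply: (le_trans (ler_normD _ _)); rewrite !normrM.
    have h4 := ler_wpM2l (ltW K0) h3.
    have h5 := ler_wpM2l (normr_ge0 (a2 - a1)) (le_trans h2 h4).
    have h6 := ler_wpM2l (normr_ge0 (b2 - b1)) h1.
    apply: (le_trans (lerD h5 h6)); rewrite -subr_ge0.
    rewrite (_ : _ - _ = K * gamma t); last by rewrite /D; ring.
    by rewrite mulr_ge0 // ltW.
rewrite /eventually_le in zK uK *.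
near=> t.
have h1 : `|u t| <= K * gamma t by near: t.
have h2 : `|w t - u t| <= C * (D * K) * gamma t by near: t.
rewrite (_ : w t = (w t - u t) + u t); last ring.
apply: (le_trans (ler_normD _ _)); apply: (le_trans (lerD h2 h1)).
by rewrite le_eqVlt; apply/orP; left; apply/eqP; ring.
Unshelve. all: by end_near. Qed.

Lemma MVT_pos (R : realType) (F f : R -> R) (s t : R) : 0 < s -> s <= t ->
  (forall u : R, 0 < u -> is_derive u 1 F (f u)) ->
  exists2 c, s <= c <= t & F t - F s = f c * (t - s).
Proof.
move=> s0 st dF.
have [||c] := @MVT_segment R F f s t st.
- by move=> u; rewrite in_itv /= => /andP[su _]; apply: dF; lra.
- apply: derivable_within_continuous => u; rewrite in_itv /= => /andP[su _].
  by have d := dF u ltac:(lra); exact: ex_derive.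
by rewrite in_itv; exists c.
Qed.

(** With [I' = f] and [J' = I], let [G t = I t - (J t - J (t - 1))].  By the mean
    value theorem [G t = I t - I c] is a window of [f].  Since
    [G' = f - (I t - I (t - 1))], the function [z = y - G] solves
    [z' = - z - G + (I t - I (t - 1))]: the forcing [f], which has no pointwise
    bound, has been replaced by windows. *)
Lemma ode_of_windows (R : realType) (q L : R) (f y gamma : R -> R) :
  0 < q < 1 -> 0 <= L -> continuous_halfline f -> tame R q L gamma ->
  (forall t : R, 0 < t -> is_derive t 1 y (- y t + f t)) ->
  linearly_controls R (windows_eventually_le R f gamma)
    (fun K => eventually_le R gamma K y).
Proof.
move=> q01 L0 cf [g0 cg sd gq] dy.
have [I [cI dI wI]] := @window_antiderivative R f cf.
have [J [_ dJ _]] := @window_antiderivative R I (continuous_subspaceT cI).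
have g0' (t : R) : 0 < t -> 0 < gamma t by move=> t0; apply: g0; exact: ltW.
have cg' (t : R) : 0 < t -> {for t, continuous gamma}.
  by move=> t0; exact: halfline_continuous_at.
have b0 : -1 < 0 :> R by rewrite oppr_lt0.
have aL : `|0 : R| * L < - -1 by rewrite normr0 mul0r opprK.
have [C C0 HC] :=
  @pantograph_comparison R q 0 (-1) L gamma q01 b0 L0 aL g0' cg' sd gq.
exists (C * 2 + 1); first by rewrite addr_gt0 // mulr_gt0.
move=> K K0 fK.
pose G t := I t - (J t - J (t - 1)).
have GK : eventually_le R gamma K G.
  rewrite /windows_eventually_le in fK; near=> t.
  have t2 : 2 <= t by near: t; apply: nbhs_pinfty_ge; exact: num_real.
  have [c /andP[c1 c2] JE] := @MVT_pos R J I (t - 1) t ltac:(lra) ltac:(lra) dJ.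
  have H : forall v, 0 <= v <= 1 -> `|window_integral f v t| <= K * gamma t.
    by near: t.
  rewrite /G JE (_ : t - (t - 1) = 1) ?mulr1; last ring.
  have := H (t - c) ltac:(lra); rewrite wI; [|lra|lra].
  by rewrite subKr.
have zK : eventually_le R gamma (C * (2 * K)) (fun t => y t - G t).
  apply: (HC _ _ (fun t => - G t + (I t - I (t - 1)))).
  - by rewrite mulr_gt0.
  - near=> t.
    have t1 : 1 < t by near: t; apply: nbhs_pinfty_gt; exact: num_real.
    have t0 : 0 < t by lra.
    have d1 := dy t t0; have d2 := dI t t0; have d3 := dJ t t0.
    have d4 : is_derive t 1 (fun s => J (s - 1)) (I (t - 1)).
      have d5 := dJ (t - 1) ltac:(lra).
      have d6 : is_derive t 1 (fun s : R => s - 1) 1.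
        by apply: is_derive_eq; ring.
      by have := @is_derive1_comp R J (fun s => s - 1) t _ _ d5 d6;
        rewrite mulr1.
    rewrite /G; apply: is_derive_eq; rewrite /G; ring.
  - rewrite /windows_eventually_le in fK; rewrite /eventually_le in GK.
    near=> t.
    have t1 : 1 < t by near: t; apply: nbhs_pinfty_gt; exact: num_real.
    have h1 : `|G t| <= K * gamma t by near: t.
    have H : forall v, 0 <= v <= 1 -> `|window_integral f v t| <= K * gamma t.
    by near: t.
    have := H 1 ltac:(lra); rewrite wI; [|lra|lra] => h2.
    by apply: (le_trans (ler_normD _ _)); rewrite normrN; lra.
rewrite /eventually_le in zK GK *.
near=> t.
have h1 : `|G t| <= K * gamma t by near: t.
have h2 : `|y t - G t| <= C * (2 * K) * gamma t by near: t.
rewrite (_ : y t = (y t - G t) + G t); last ring.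
apply: (le_trans (ler_normD _ _)); apply: (le_trans (lerD h2 h1)).
by rewrite le_eqVlt; apply/orP; left; apply/eqP; ring.
Unshelve. all: by end_near. Qed.

(** Since [f = y' + y], the window is [y t - y (t - v)] plus the integral of [y]
    over it.  Each of the values of [y] involved is at most [2 K gamma t], the one
    at [t] at most [K gamma t], which explains the constant 5. *)
Lemma windows_of_ode (R : realType) (f y gamma : R -> R) :
  continuous_halfline f -> continuous_halfline y -> slowly_decreasing R gamma ->
  (forall t : R, 0 < t -> is_derive t 1 y (- y t + f t)) ->
  linearly_controls R (fun K => eventually_le R gamma K y)
    (windows_eventually_le R f gamma).
Proof.
move=> cf cy sd dy.
have [I [_ dI wI]] := @window_antiderivative R f cf.
have [Y [_ dY _]] := @window_antiderivative R y cy.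
have dD (t : R) : 0 < t -> is_derive t 1 (fun s => I s - y s - Y s) 0.
  move=> t0; have d1 := dI t t0; have d2 := dY t t0; have d3 := dy t t0.
  by apply: is_derive_eq; ring.
exists 5 => // K K0 /near_pinftyP[T T0 HT].
have sd1 := sd 1 ltr01.
near=> t => v v01.
have tT : T + 2 <= t by near: t; apply: nbhs_pinfty_ge; exact: num_real.
have Hg : forall v, 0 <= v <= 1 -> gamma (t - v) <= (1 + 1) * gamma t.
  by near: t.
have yK s : t - 1 <= s <= t -> `|y s| <= K * (2 * gamma t).
  move=> hs; apply: (le_trans (HT s _)); first lra.
  apply: ler_wpM2l; first exact: ltW.
  by have := Hg (t - s) ltac:(lra); rewrite subKr; lra.
rewrite wI; [|lra|lra].
have [c _ DE] := @MVT_pos R _ (fun=> 0) (t - v) t ltac:(lra) ltac:(lra) dD.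
have [c' hc' YE] := @MVT_pos R _ y (t - v) t ltac:(lra) ltac:(lra) dY.
have -> : I t - I (t - v) = y t - y (t - v) + y c' * v.
  move: DE YE; rewrite mul0r (_ : t - (t - v) = v); last ring.
  lra.
have h1 := HT t ltac:(lra).
have h2 := yK (t - v) ltac:(lra).
have h3 := yK c' ltac:(lra).
have h4 : `|y c' * v| <= `|y c'|.
  by rewrite normrM ler_piMr // ger0_norm; lra.
apply: (le_trans (ler_normD _ _)); have := ler_normB (y t) (y (t - v)).
lra.
Unshelve. all: by end_near. Qed.

(** * Asymptotic conditions as eventual bounds *)

Lemma eqO_eventually_le (R : realType) (g gamma : R -> R) :
  (forall t : R, 0 <= t -> 0 < gamma t) ->
  g =O_at_infty gamma <-> exists2 K : R, 0 < K & eventually_le R gamma K g.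
Proof.
move=> g0; split.
  move=> /eqO_exP [K K0 HK]; exists K => //; rewrite /eventually_le.
  near=> t.
  have t0 : 0 <= t by near: t; apply: nbhs_pinfty_ge; exact: num_real.
  by rewrite -(gtr0_norm (g0 t t0)); near: t.
move=> [K K0 HK]; apply/eqO_exP; exists K => //.
rewrite /eventually_le in HK; near=> t.
have t0 : 0 <= t by near: t; apply: nbhs_pinfty_ge; exact: num_real.
by rewrite (gtr0_norm (g0 t t0)); near: t.
Unshelve. all: by end_near. Qed.

Lemma eqo_eventually_le (R : realType) (g gamma : R -> R) :
  (forall t : R, 0 <= t -> 0 < gamma t) ->
  g =o_at_infty gamma <-> forall K : R, 0 < K -> eventually_le R gamma K g.
Proof.
move=> g0; split.
  move=> /eqoP H K K0; have HK := H K K0; rewrite /eventually_le.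
  near=> t.
  have t0 : 0 <= t by near: t; apply: nbhs_pinfty_ge; exact: num_real.
  by rewrite -(gtr0_norm (g0 t t0)); near: t.
move=> H; apply/eqoP => K K0; have HK := H K K0.
rewrite /eventually_le in HK; near=> t.
have t0 : 0 <= t by near: t; apply: nbhs_pinfty_ge; exact: num_real.
by rewrite (gtr0_norm (g0 t t0)); near: t.
Unshelve. all: by end_near. Qed.

Lemma limsup_ratio_le (R : realType) (g gamma : R -> R) (K : R) :
  (forall t : R, 0 <= t -> 0 < gamma t) ->
  eventually_le R gamma K g -> (limsup_ratio g gamma <= K%:E)%E.
Proof.
move=> g0 /near_pinftyP[T T0 HT]; rewrite /limsup_ratio limf_esupE.
apply: (@le_trans _ _ (ereal_sup
  ((fun t => (`|g t| / gamma t)%:E) @` [set t | T <= t]))).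
  apply: ereal_inf_lbound; exists [set t | T <= t] => //.
  by apply: nbhs_pinfty_ge; exact: num_real.
apply: ge_ereal_sup => _ [t /= Tt <-].
by rewrite lee_fin ler_pdivrMr ?HT // g0 //; lra.
Qed.

Lemma eventually_le_limsup_ratio (R : realType) (g gamma : R -> R) (K : R) :
  (forall t : R, 0 <= t -> 0 < gamma t) ->
  (limsup_ratio g gamma < K%:E)%E -> eventually_le R gamma K g.
Proof.
move=> g0; rewrite /limsup_ratio limf_esupE.
move=> /ereal_inf_lt [_ [V FV <-] VK].
rewrite /eventually_le; near=> t.
have t0 : 0 <= t by near: t; apply: nbhs_pinfty_ge; exact: num_real.
rewrite -ler_pdivrMr ?g0 // -lee_fin.
apply: le_trans (ltW VK); apply: ereal_sup_ubound; exists t => //.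
by near: t.
Unshelve. all: by end_near. Qed.

Lemma limsup_ratio_pinfty (R : realType) (g gamma : R -> R) :
  (forall t : R, 0 <= t -> 0 < gamma t) ->
  (limsup_ratio g gamma < +oo)%E <-> g =O_at_infty gamma.
Proof.
move=> g0; rewrite eqO_eventually_le //; split.
  move=> lt.
  have [K K0 lK] : exists2 K : R, 0 < K & (limsup_ratio g gamma < K%:E)%E.
    case: (limsup_ratio g gamma) lt => // [r _|_]; last first.
      by exists 1; rewrite ?ltNyr.
    exists (`|r| + 1); first by rewrite ltr_wpDl.
    by rewrite lte_fin; have := ler_norm r; lra.
  by exists K => //; exact: eventually_le_limsup_ratio.
by move=> [K K0 /limsup_ratio_le] => /(_ g0) h; apply: le_lt_trans h (ltry _).
Qed.

Lemma limsup_ratio_gt0 (R : realType) (g gamma : R -> R) :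
  (forall t : R, 0 <= t -> 0 < gamma t) ->
  (0 < limsup_ratio g gamma)%E <-> ~ (g =o_at_infty gamma).
Proof.
move=> g0; rewrite eqo_eventually_le //; split.
  move=> l0 H; move: l0; rewrite ltNge => /negP; apply.
  apply/lee_addgt0Pr => K K0; rewrite add0e.
  by apply: limsup_ratio_le => //; exact: H.
move=> nH; rewrite ltNge; apply/negP => l0; apply: nH => K K0.
apply: eventually_le_limsup_ratio => //.
by apply: le_lt_trans l0 _; rewrite lte_fin.
Qed.

Lemma limsup_ratio_between (R : realType) (g gamma : R -> R) :
  (forall t : R, 0 <= t -> 0 < gamma t) ->
  (0 < limsup_ratio g gamma < +oo)%E <->
  g =O_at_infty gamma /\ ~ (g =o_at_infty gamma).
Proof.
move=> g0; split.
  by move=> /andP[/(limsup_ratio_gt0 _ _ _ g0) ?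
    /(limsup_ratio_pinfty _ _ _ g0) ?].
move=> [/(limsup_ratio_pinfty _ _ _ g0) h1 /(limsup_ratio_gt0 _ _ _ g0) h2].
exact/andP.
Qed.

Lemma window_sup_le (R : realType) (f : R -> R) (t K : R) :
  (window_sup f t <= K%:E)%E <->
  forall v : R, 0 <= v <= 1 -> `|window_integral f v t| <= K.
Proof.
split.
  move=> H v v01; rewrite -lee_fin; apply: le_trans H.
  by apply: ereal_sup_ubound; exists v => //=; rewrite in_itv.
move=> H; apply: ge_ereal_sup => _ [v /= + <-]; rewrite in_itv /= => v01.
by rewrite lee_fin H.
Qed.

(** From an eventual bound to all [t >= 0]: on the compact interval before it
    takes effect the windows are bounded and [gamma] is bounded away from 0. *)
Lemma cond_alphaP (R : realType) (f gamma : R -> R) :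
  continuous_halfline f -> continuous_halfline gamma ->
  (forall t : R, 0 <= t -> 0 < gamma t) ->
  cond_alpha f gamma <->
  exists2 K : R, 0 < K & windows_eventually_le R f gamma K.
Proof.
move=> cf cg g0; split.
  move=> [K K0 HK]; exists K => //; rewrite /windows_eventually_le.
  near=> t => v v01; move: v v01; apply/window_sup_le; apply: HK.
  by near: t; apply: nbhs_pinfty_ge; exact: num_real.
move=> [K K0 /near_pinftyP[T T0 HT]].
have [I [cI _ wI]] := @window_antiderivative R f cf.
have [B B0 HB] : exists2 B : R, 0 < B &
    forall t : R, -1 <= t <= T -> `|I t| <= B * 1.
  apply: (@bounded_ratio R I (fun=> 1)) => // t _; first exact: cI.
  exact: cst_continuous.
pose gamma' (t : R) := gamma (Num.max t 0).
have gE (t : R) : 0 <= t -> gamma' t = gamma t.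
  by move=> t0; rewrite /gamma' max_l.
have [M M0 HM] : exists2 M : R, 0 < M &
    forall t : R, 0 <= t <= T -> `|2 * B| <= M * gamma' t.
  apply: (@bounded_ratio R (fun=> 2 * B) gamma') => t /andP[t0 _].
  - exact: cst_continuous.
  - exact: halfline_extension_continuous.
  - by rewrite gE // g0.
exists (K + M); first exact: addr_gt0.
move=> t t0; apply/window_sup_le => v v01.
have gt0 := g0 t t0; rewrite mulrDl.
have [Tt|tT] := leP T t.
  apply: (le_trans (HT t Tt v v01)); rewrite lerDl; apply: mulr_ge0; exact: ltW.
have := HM t ltac:(lra); rewrite gE // ger0_norm; last by lra.
have Kg : 0 < K * gamma t by rewrite mulr_gt0.
rewrite wI; [|lra|lra].
have h1 := HB t ltac:(lra); have h2 := HB (t - v) ltac:(lra).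
have := ler_normB (I t) (I (t - v)); lra.
Unshelve. all: by end_near. Qed.

(** This is where pointwise smallness of the windows becomes uniform. *)
Lemma cond_betaP (R : realType) (q L : R) (f gamma : R -> R) :
  continuous_halfline f -> tame R q L gamma ->
  cond_beta f gamma <->
  forall K : R, 0 < K -> windows_eventually_le R f gamma K.
Proof.
move=> cf [g0 cg sd _]; split; last first.
  move=> H v v01; apply/eqo_eventually_le => // K K0.
  have HK := H K K0; rewrite /windows_eventually_le in HK.
  rewrite /eventually_le; near=> t; move: v v01; near: t.
  exact: HK.
move=> H.
have [I [cI _ wI]] := @window_antiderivative R f cf.
move=> K K0.
have gge0 : \forall t \near +oo, 0 <= gamma t.
  near=> t; apply/ltW/g0; near: t; apply: nbhs_pinfty_ge; exact: num_real.
have H' v e : 0 <= v <= 1 -> 0 < e ->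
    \forall t \near +oo, `|I t - I (t - v)| <= e * gamma t.
  move=> v01 e0.
  have := (eqo_eventually_le R _ _ g0).1 (H v v01) e e0.
  rewrite /eventually_le => He; near=> t.
  rewrite -wI; first by near: t.
    by near: t; apply: nbhs_pinfty_ge; exact: num_real.
  by lra.
have C1 : 1 <= 1 + 1 :> R by rewrite lerDl ler01.
have := uniform_window R I gamma (1 + 1) cI C1 gge0 (sd 1 ltr01) H' K K0.
rewrite /windows_eventually_le => HK; near=> t => v v01.
rewrite wI; [|by near: t; apply: nbhs_pinfty_ge; exact: num_real|by lra].
by move: v v01; near: t.
Unshelve. all: by end_near. Qed.

(** The window of length 0 vanishes, so a failure of (beta) is witnessed by a
    positive length. *)
Lemma cond_deltaP (R : realType) (f gamma : R -> R) :
  (forall t : R, 0 <= t -> 0 < gamma t) ->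
  cond_delta f gamma <-> ~ cond_beta f gamma.
Proof.
move=> g0; split.
  move=> [v v01 /(limsup_ratio_gt0 _ _ _ g0) nv] H; apply: nv; apply: H.
  by lra.
move=> nb; apply: contrapT => nd; apply: nb => v v01.
have [v0|v0] := eqVneq v 0.
  apply/eqo_eventually_le => // K K0; rewrite /eventually_le; near=> t.
  have t0 : 0 <= t by near: t; apply: nbhs_pinfty_ge; exact: num_real.
  rewrite /window_integral v0 subr0 max_l // set_itv1 Rintegral_set1 normr0.
  by rewrite mulr_ge0 // ltW // g0.
apply: contrapT => nv; apply: nd; exists v; last exact/limsup_ratio_gt0.
have [v0' v1] := andP v01.
by rewrite lt_def v0 v0'.
Unshelve. all: by end_near. Qed.

Lemma weight_tame (R : realType) (q a b : R) (gamma : R -> R) :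
  0 < q < 1 -> a != 0 -> b < 0 -> `|a| < `|b| ->
  (forall t : R, 0 <= t -> 0 < gamma t) ->
  continuous_halfline gamma ->
  (exists2 eta : R, - (ln `|b / a| / ln (1 / q)) < eta &
     regularly_varying eta gamma) \/
  (forall s t : R, 0 <= s -> s <= t -> gamma s <= gamma t) ->
  exists L : R, [/\ 0 <= L, `|a| * L < - b & tame R q L gamma].
Proof.
move=> q01 a0 b0 ab g0 cg [[eta keta rv]|gmono].
  have [L [L0 aL gq]] :=
    regularly_varying_scale R q a b eta gamma q01 a0 b0 keta rv.
  exists L; split=> //; split=> //.
  exact: regularly_varying_slowly_decreasing cg rv.
exists 1; rewrite mulr1 -(ltr0_norm b0); split=> //; split=> //.
  exact: nondecreasing_slowly_decreasing.
near=> t; rewrite mul1r.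
have t0 : 0 < t by near: t; apply: nbhs_pinfty_gt; exact: num_real.
apply: gmono; nra.
Unshelve. all: by end_near. Qed.

(** * The equivalences *)

Theorem theorem9 (R : realType) (q a b zeta : R) (f x y gamma : R -> R)
  (hq0 : 0 < q) (hq1 : q < 1) (ha : a != 0) (hb : b < 0) (hab : `|a| < `|b|)
  (hf : continuous_halfline f)
  (hx : pantograph_solution q a b zeta f x)
  (hy : ode_solution f y)
  (hgamma_pos : forall t : R, 0 <= t -> 0 < gamma t)
  (hgamma_cont : continuous_halfline gamma)
  (hgamma :
    (exists2 eta : R, - (ln `|b / a| / ln (1 / q)) < eta &
       regularly_varying eta gamma) \/
    [/\ forall s t : R, 0 <= s -> s <= t -> gamma s <= gamma t,
        C1_halfline gamma
      & gamma t @[t --> +oo] --> +oo]) :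
  [/\ [<-> cond_alpha f gamma; y =O_at_infty gamma; x =O_at_infty gamma],
      [<-> cond_beta f gamma; y =o_at_infty gamma; x =o_at_infty gamma]
    & [<-> cond_alpha f gamma /\ cond_delta f gamma;
           (0 < limsup_ratio y gamma < +oo)%E;
           (0 < limsup_ratio x gamma < +oo)%E]].
Proof.
have q01 : 0 < q < 1 by rewrite hq0.
have [L [L0 aL tg]] : exists L : R,
    [/\ 0 <= L, `|a| * L < - b & tame R q L gamma].
  apply: (weight_tame R q a b gamma q01 ha hb hab hgamma_pos hgamma_cont).
  by case: hgamma => [rv|[gmono _ _]]; [left|right].
have [_ [dx _] _] := hx.
have [cy [dy _] _] := hy.
have [_ _ sd _] := tg.
have dy0 (t : R) : 0 < t -> is_derive t 1 y (0 * y (q * t) + -1 * y t + f t).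
  by move=> t0; rewrite mul0r add0r mulN1r; exact: dy.
have aL0 : `|0 : R| * L < - -1 by rewrite normr0 mul0r opprK.
have b0 : -1 < 0 :> R by rewrite oppr_lt0.
have fy := ode_of_windows R q L f y gamma q01 L0 hf tg dy.
have yf := windows_of_ode R f y gamma hf cy sd dy.
have yx :=
  pantograph_transfer R q L 0 (-1) a b gamma f y x q01 L0 hb aL tg dy0 dx.
have xy :=
  pantograph_transfer R q L a b 0 (-1) gamma f x y q01 L0 b0 aL0 tg dx dy0.
have alphaE := cond_alphaP R f gamma hf hgamma_cont hgamma_pos.
have betaE := cond_betaP R q L f gamma hf tg.
have OE g := eqO_eventually_le R g gamma hgamma_pos.
have oE g := eqo_eventually_le R g gamma hgamma_pos.
have yO : cond_alpha f gamma <-> y =O_at_infty gamma.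
  rewrite alphaE OE; split; exact: linearly_controls_ex.
have yo : cond_beta f gamma <-> y =o_at_infty gamma.
  rewrite betaE oE; split; exact: linearly_controls_all.
have xO : y =O_at_infty gamma <-> x =O_at_infty gamma.
  rewrite !OE; split; exact: linearly_controls_ex.
have xo : y =o_at_infty gamma <-> x =o_at_infty gamma.
  rewrite !oE; split; exact: linearly_controls_all.
have ys := limsup_ratio_between R y gamma hgamma_pos.
have xs := limsup_ratio_between R x gamma hgamma_pos.
have dE := cond_deltaP R f gamma hgamma_pos.
clear - yO yo xO xo ys xs dE.
split; tfae; rewrite ?ys ?xs ?dE; tauto.
Qed.
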